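(* Let $A,B\in\mathbb{R}^{N\times N}$ be symmetric and let $\omega>0$, $\Delta t>0$ with $\sin(\omega\Delta t)\neq 0$. Put $$\alpha=\frac{(\omega\Delta t)^2}{2-2\cos(\omega\Delta t)},\quad \beta=\frac{\omega\Delta t}{\sin(\omega\Delta t)},\quad K=\frac{\Delta t^2}{\alpha}A-\frac{\Delta t\,\beta(1-\cos(\omega\Delta t))}{\alpha}B,\quad L=\frac{\beta\,\Delta t}{\alpha}B .$$ Assume that $H=-\omega^2 I+i\omega B+A$ is non-singular, that $K$ and $L$ are positive semidefinite, and that $4I-K-2L$ is positive definite. Let $\chi$ be a $C^\infty$ admissible window function and let $S_T^{\rm abd}$ be the associated time-domain approximate solution operator. Then $$\lim_{T\to\infty}S_T^{\rm abd}=H^{-1},$$ where $T$ runs through the positive reals for which $2\pi T/(\omega\Delta t)$ is an integer.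
   Context: Admissible window function: a function $\chi:\mathbb{R}\to\mathbb{R}$ is a $C^k$ admissible window function if it is even, is of class $C^k$, and satisfies $\chi(0)=1$, $\chi(x)=0$ for $x\ge 1$, and $\chi$ is non-increasing on $[0,1]$. Time-domain approximate solution operator (backward differences version): let $T>0$ be such that $n_{\rm steps}:=2\pi\omega^{-1}T/\Delta t$ is an integer. For $F\in\mathbb{C}^N$ set $f_n=\chi\bigl(1-\tfrac{n\Delta t}{2\pi\omega^{-1}T}\bigr)e^{i\omega n\Delta t}F$, and define $u_n\in\mathbb{C}^N$ by $u_{-1}=u_0=0$ and, for $n\ge0$, $$u_{n+1}=(2I-K-L)u_n-(I-L)u_{n-1}+\tfrac{\Delta t^2}{\alpha}f_n .$$ Then $S_T^{\rm abd}:\mathbb{C}^N\to\mathbb{C}^N$ is the linear map $S_T^{\rm abd}F=e^{-i2\pi T}u_{n_{\rm steps}}$. *)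

(* Defs.v *)
From HB Require Import structures.
From mathcomp Require Import all_boot all_order all_algebra.
From mathcomp Require Import all_classical all_reals all_analysis.
From mathcomp Require Import complex.

Set Implicit Arguments.
Unset Strict Implicit.
Unset Printing Implicit Defensive.

Import Order.TTheory GRing.Theory Num.Theory.
Import numFieldNormedType.Exports.

Local Open Scope classical_set_scope.
Local Open Scope ring_scope.
Local Open Scope complex_scope.

(* The topology of [R[i]], given by its modulus; 'M[R[i]]_(m, n) inherits from
   it the topology of entrywise convergence. *)
HB.instance Definition _ (R : realType) :=
  PseudoMetricNormedZmod.copy R[i] R[i]^o.

Section Windows.
Variable R : realType.
Implicit Types (f chi : R -> R) (k : nat).

Definition class_Ck k f :=
  (forall j, (j < k)%N -> forall x, derivable (derive1n j f) x 1) /\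
  continuous (derive1n k f).

Definition class_Cinf f := forall k, class_Ck k f.

(* The regularity class [reg] is meant to be [class_Ck k] or [class_Cinf]. *)
Record admissible_window (reg : (R -> R) -> Prop) chi : Prop := {
  window_even : forall x, chi (- x) = chi x;
  window_reg : reg chi;
  window0 : chi 0 = 1;
  window_ge1 : forall x, 1 <= x -> chi x = 0;
  window_decr : forall x y, 0 <= x -> x <= y -> y <= 1 -> chi y <= chi x }.

End Windows.

Section Definite.
Variables (R : realType) (N : nat).

Definition psdmx (M : 'M[R]_N) : Prop :=
  M^T = M /\ forall x : 'cV[R]_N, 0 <= (x^T *m M *m x) 0 0.

Definition posdefmx (M : 'M[R]_N) : Prop :=
  M^T = M /\ forall x : 'cV[R]_N, x != 0 -> 0 < (x^T *m M *m x) 0 0.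

End Definite.

Definition expi (R : realType) (t : R) : R[i] := cos t +i* sin t.

Definition toC (R : realType) m n (M : 'M[R]_(m, n)) : 'M[R[i]]_(m, n) :=
  map_mx (real_complex R) M.

Definition mx_of_op (R : realType) N (S : 'cV[R[i]]_N -> 'cV[R[i]]_N) :
  'M[R[i]]_N := \matrix_(i, j) S (delta_mx j 0) i 0.

Lemma mx_of_opP (R : realType) N (S : 'cV[R[i]]_N -> 'cV[R[i]]_N) :
  linear S -> forall F, mx_of_op S *m F = S F.
Proof.
move=> linS F.
pose mS := GRing.isLinear.Build _ _ _ _ S linS.
pose S' : {linear _ -> _} := HB.pack S mS.
rewrite -[S]/(S' : _ -> _); apply/matrixP => i j; rewrite ord1 mxE.
rewrite [F in RHS]matrix_sum_delta linear_sum summxE; apply: eq_bigr => k _.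
by rewrite big_ord1 linearZ /= !mxE mulrC.
Qed.

Section Scheme.
Variables (R : realType) (N : nat) (A B : 'M[R]_N) (omega dt : R).

Definition abd_alpha : R := (omega * dt) ^+ 2 / (2 - 2 * cos (omega * dt)).

Definition abd_beta : R := omega * dt / sin (omega * dt).

Definition abd_K : 'M[R]_N :=
  (dt ^+ 2 / abd_alpha) *: A
  - (dt * abd_beta * (1 - cos (omega * dt)) / abd_alpha) *: B.

Definition abd_L : 'M[R]_N := (abd_beta * dt / abd_alpha) *: B.

Definition helmholtz : 'M[R[i]]_N :=
  - (omega ^+ 2)%:C%:M + ('i%C * omega%:C) *: toC B + toC A.

Variable chi : R -> R.

Definition abd_rhs (T : R) (F : 'cV[R[i]]_N) (n : nat) : 'cV[R[i]]_N :=
  ((chi (1 - n%:R * dt / (2 * pi * omega^-1 * T)))%:C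
     * expi (omega * n%:R * dt)) *: F.

(* The pair (u_n, u_{n-1}); the recursion starts from u_0 = u_{-1} = 0. *)
Fixpoint abd_state (T : R) (F : 'cV[R[i]]_N) (n : nat) :
    'cV[R[i]]_N * 'cV[R[i]]_N :=
  if n is m.+1 then
    let: (u, uprev) := abd_state T F m in
    ((2%:M - toC abd_K - toC abd_L) *m u - (1%:M - toC abd_L) *m uprev
       + (dt ^+ 2 / abd_alpha)%:C *: abd_rhs T F m,
     u)
  else (0, 0).

Definition abd_nsteps (T : R) : R := 2 * pi * omega^-1 * T / dt.

Definition abd_times : set R :=
  [set T | 0 < T /\ abd_nsteps T \is a Num.int].

(* [Num.truncn] is exact for [T] in [abd_times]. *)
Definition abd_op (T : R) (F : 'cV[R[i]]_N) : 'cV[R[i]]_N :=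
  expi (- (2 * pi * T)) *: (abd_state T F (Num.truncn (abd_nsteps T))).1.

Definition abd_mx (T : R) : 'M[R[i]]_N := mx_of_op (abd_op T).

Lemma abd_state_linear T n (a : R[i]) (F G : 'cV[R[i]]_N) :
  abd_state T (a *: F + G) n =
    (a *: (abd_state T F n).1 + (abd_state T G n).1,
     a *: (abd_state T F n).2 + (abd_state T G n).2).
Proof.
elim: n => [|n IHn] /=; first by rewrite !scaler0 !addr0.
rewrite IHn.
case: (abd_state T F n) => u v; case: (abd_state T G n) => u' v' /=.
congr pair; rewrite /abd_rhs; set g := _ * expi _; set c := _%:C.
have -> : c *: (g *: (a *: F + G)) = a *: (c *: (g *: F)) + c *: (g *: G).
  rewrite !scalerDr !scalerA; congr (_ *: _ + _).
  by rewrite [LHS]mulrC mulrA.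
rewrite !mulmxDr -!scalemxAr !scalerDr scalerN opprD.
by rewrite [X in X + _ = _]addrACA [LHS]addrACA.
Qed.

Lemma abd_op_linear T : linear (abd_op T).
Proof.
move=> a F G; rewrite /abd_op abd_state_linear /= scalerDr.
by rewrite !scalerA mulrC.
Qed.

Lemma abd_mxE T F : abd_mx T *m F = abd_op T F.
Proof. exact: mx_of_opP (@abd_op_linear T) F. Qed.

End Scheme.

(* Main.v *)
(* With z = e^{i omega dt}, the states z^-n (u_n, u_(n-1)) satisfy
   X_(n+1) = Q X_n + g_n G, where g_n = chi (1 - n / M) and M is the number of
   steps. The value 1 is not an eigenvalue of Q since the symbol of the scheme
   at z is a nonzero multiple of H, and W = (1 - Q)^-1 G has first component
   H^-1 F. Since chi vanishes beyond 1, summation by parts has no boundary term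
   at n = 0; three steps of it give
     X_M = chi(1/M) W + (first and second differences of g)
           + (response to third differences of g).
   The third differences are O(M^-3), and the powers of Q grow at most linearly
   because the homogeneous leapfrog scheme dissipates a definite discrete energy
   controlling u_n - u_(n-1). Hence X_M = W + O(1/M). *)
Require Import Defs.
From HB Require Import structures.
From mathcomp Require Import all_boot all_order all_algebra.
From mathcomp Require Import all_classical all_reals all_analysis.
From mathcomp Require Import complex ring lra.
Import Order.TTheory GRing.Theory Num.Theory.
Import numFieldNormedType.Exports.
Local Open Scope classical_set_scope.
Local Open Scope ring_scope.

(* A backward difference in [n] once [x = 1 - n%:R * h]. *)
Definition shift_diff {R : realType} (h : R) (f : R -> R) (x : R) : R :=
  f x - f (x + h).

(** * Differences of a smooth function at a fixed step *)

Section ShiftDiff.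
Variables (R : realType) (h : R).
Hypothesis h_ge0 : 0 <= h.

Lemma shift_diff_eq0 (f : R -> R) :
  (forall x, 1 <= x -> f x = 0) -> forall x, 1 <= x -> shift_diff h f x = 0.
Proof.
move=> f0 x x1; rewrite /shift_diff !f0 ?subr0 //.
by rewrite (le_trans x1) // lerDl.
Qed.

Lemma is_derive_shift_diff (f f' : R -> R) :
  (forall x : R, is_derive x 1 f (f' x)) ->
  forall x : R, is_derive x 1 (shift_diff h f) (shift_diff h f' x).
Proof.
move=> df x.
have dfh : is_derive x 1 (f \o (fun y => y + h)) (f' (x + h) * 1).
  apply: is_derive1_comp.
  by have := is_deriveD (is_derive_id x 1) (is_derive_cst h x 1); rewrite addr0.
have := is_deriveB (df x) dfh.
by rewrite mulr1.
Qed.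

Lemma is_derive_iter_shift_diff (f : nat -> R -> R) :
  (forall k (x : R), is_derive x 1 (f k) (f k.+1 x)) ->
  forall J k (x : R), is_derive x 1 (iter J (shift_diff h) (f k))
                             (iter J (shift_diff h) (f k.+1) x).
Proof.
move=> df; elim=> [|J IH] k x //=.
by apply: is_derive_shift_diff => y; exact: IH.
Qed.

(** By the mean value theorem each difference trades one derivative for a factor [h]; [k] stays free
    in the induction because that derivative is the next member of the family. The intermediate
    point lies to the right of [x], so bounds on the nonnegative half-line suffice. *)
Lemma iter_shift_diff_le (f : nat -> R -> R) (c : R) J :
  (forall k (x : R), is_derive x 1 (f k) (f k.+1 x)) ->
  (forall k x, (k <= J)%N -> 0 <= x -> `|f k x| <= c) ->
  forall j k x, (j + k <= J)%N -> 0 <= x ->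
    `|iter j (shift_diff h) (f k) x| <= c * h ^+ j.
Proof.
move=> df bf; elim=> [|j IH] k x jkJ x0 /=.
  by rewrite expr0 mulr1; apply: bf.
have dD y := is_derive_iter_shift_diff _ df j k y.
have xh : x <= x + h by rewrite lerDl.
have cD : {within `[x, x + h], continuous (iter j (shift_diff h) (f k))}.
  apply: derivable_within_continuous => y _.
  exact: (@ex_derive _ _ _ _ _ _ _ (dD y)).
have [y] := @MVT_segment R _ _ x (x + h) xh (fun y _ => dD y) cD.
rewrite in_itv /= => /andP[xy _] E.
rewrite /shift_diff distrC E addrAC subrr add0r normrM (ger0_norm h_ge0).
rewrite exprSr mulrA ler_wpM2r // IH ?(le_trans x0) //.
by rewrite addnS -addSn.
Qed.

End ShiftDiff.

(** * Summation by parts for a forced linear recursion *)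

Section Forced.
Variables (R : realType) (V : lmodType R[i]) (Q : {linear V -> V}).
Implicit Types (h : R) (f : R -> R) (G W : V).

Fixpoint forced h f G (n : nat) : V :=
  if n is m.+1 then
    Q (forced h f G m) + (real_complex R (f (1 - m%:R * h))) *: G
  else 0.

Lemma forcedS h f G n :
  forced h f G n.+1
  = Q (forced h f G n) + (real_complex R (f (1 - n%:R * h))) *: G.
Proof. by []. Qed.

Lemma forced_sum h f G n :
  forced h f G n =
    \sum_(k < n) real_complex R (f (1 - k%:R * h)) *: iter (n - k.+1) Q G.
Proof.
elim: n => [|n IH] /=; first by rewrite big_ord0.
rewrite big_ord_recr /= subnn IH linear_sum; congr (_ + _).
by apply: eq_bigr => k _; rewrite linearZ /= subSS -iterS -subSn.
Qed.

(** With [f_n = f (1 - n h)] and [G = W - Q W], subtracting [f_n W] from the response at [n.+1]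
    leaves a sequence driven by [- (f_n - f_(n-1)) Q W], a source of the same shape. *)
Lemma forced_by_parts h f G W n : 0 <= h ->
    (forall x, 1 <= x -> f x = 0) -> W - Q W = G ->
  forced h f G n.+1 = real_complex R (f (1 - n%:R * h)) *: W
                      + forced h (shift_diff h f) (- Q W) n.+1.
Proof.
move=> h0 f0 <-; elim: n => [|n IH].
  rewrite /= /shift_diff mul0r subr0 !f0 ?lerDl // subr0 raddf0 !scale0r.
  by rewrite !addr0.
rewrite forcedS IH [in RHS]forcedS [in RHS]/shift_diff.
have -> : 1 - n.+1%:R * h + h = 1 - n%:R * h by rewrite -natr1; ring.
set Y := forced _ _ _ _; rewrite linearD linearZ rmorphB /= scalerBl.
rewrite scalerBr !scalerN opprK [RHS]addrCA [X in X + _]addrC -!addrA.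
by congr (_ + _); rewrite [in RHS]addrA addrC.
Qed.

Variable phi : {linear V -> R[i]^o}.

(** In the sum over past sources each of the [n] terms is at most [c * a * n]. Measuring through a
    functional [phi] avoids choosing a norm on [V]. *)
Lemma forced_le h f G (c a : R) n : 0 <= h ->
    (forall k, (k < n)%N -> `|f (1 - k%:R * h)| <= c) ->
    (forall k, `|phi (iter k Q G)| <= real_complex R (a * k.+1%:R)) ->
  `|phi (forced h f G n)| <= real_complex R (c * a * n%:R ^+ 2).
Proof.
move=> h0 fc Qa; rewrite forced_sum linear_sum /=.
apply: (le_trans (ler_norm_sum _ _ _)).
apply: (@le_trans _ _ (\sum_(k < n) real_complex R (c * (a * n%:R)))); last
  first.
  by rewrite sumr_const card_ord -rmorphMn /= lecR -mulr_natr expr2 !mulrA.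
apply: ler_sum => k _; rewrite linearZ /= normrM rmorphM.
apply: ler_pM => //.
  by rewrite normc_def /= expr0n addr0 sqrtr_sqr lecR fc.
apply: (le_trans (Qa _)); rewrite lecR; apply: ler_wpM2l.
  by have := le_trans (normr_ge0 _) (Qa 0); rewrite ler0c mulr1.
by rewrite ler_nat -subSn // subSS leq_subr.
Qed.

(** Three summations by parts match the growth of [Q]: the remainder costs [n ^ 2] by [forced_le],
    while third differences gain [n ^ -3]. *)
Lemma forced_rate (f : nat -> R -> R) (c : R) G W :
    (forall k (x : R), is_derive x 1 (f k) (f k.+1 x)) ->
    (forall k x, (k <= 3)%N -> 0 <= x -> `|f k x| <= c) ->
    (forall x, 1 <= x -> f 0 x = 0) -> f 0 0 = 1 ->
    (forall G, exists W, W - Q W = G) ->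
    (forall G, exists a : R, forall n,
       `|phi (iter n Q G)| <= real_complex R (a * n.+1%:R)) ->
    W - Q W = G ->
  exists C : R, forall n, (0 < n)%N ->
    `|phi (forced n%:R^-1 (f 0) G n) - phi W| <= real_complex R (C / n%:R).
Proof.
move=> df bf f1 f00 Qsolve Qgrow WG.
have [W1 E1] := Qsolve (- Q W).
have [W2 E2] := Qsolve (- Q W1).
have [a Ha] := Qgrow (- Q W2).
have [re reE] : exists re : R[i] -> R, forall z, `|z| = real_complex R (re z).
  by exists (fun z => complex.Re `|z|) => z; rewrite RRe_real ?normr_real.
(* The summands account for the error [f 0 h - 1], the first and second differences at [h], and the
   remainder, in that order. *)
exists (c * re (phi W) + c * re (phi W1) + c * re (phi W2) + c * a).
move=> [//|m] _; set n := m.+1; set h := n%:R^-1.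
have n0 : 0 < n%:R :> R by rewrite ltr0n.
have h0 : 0 <= h by rewrite invr_ge0 ltW.
have hn : h * n%:R = 1 by rewrite /h mulVf // gt_eqF.
have h1 : h <= 1 by rewrite invf_le1 // ler1n.
(* After [n = m.+1] steps the last sample is taken at [h], not at 0. *)
have mh : 1 - m%:R * h = h.
  by move: hn; rewrite /n -natr1; lra.
set D := shift_diff h.
have vanish := shift_diff_eq0 _ h h0.
rewrite (forced_by_parts _ _ _ _ _ h0 f1 WG) mh.
rewrite (forced_by_parts _ _ _ _ _ h0 (vanish _ f1) E1) mh.
rewrite (forced_by_parts _ _ _ _ _ h0 (vanish _ (vanish _ f1)) E2) mh.
have Dle j k x := iter_shift_diff_le _ _ h0 _ c 3 df bf j k x.
have c0 : 0 <= c by apply: le_trans (bf 0 0 _ _).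
have D1 : `|D (f 0) h| <= c * h by exact: (Dle 1 0).
have D2 : `|D (D (f 0)) h| <= c * h.
  apply: le_trans (Dle 2 0 h _ _) _ => //.
  by rewrite expr2 mulrA ler_piMr // mulr_ge0.
(* As [f 0 0 = 1], this is a first difference at 0. *)
have D0 : `|f 0 h - 1| <= c * h.
  have := Dle 1 0 0 isT (lexx _).
  by rewrite /= /shift_diff add0r f00 distrC.
have D3 : `|phi (forced h (D (D (D (f 0)))) (- Q W2) n)| <=
    real_complex R (c * a * h).
  have {}Ha := forced_le _ _ _ (c * h ^+ 3) _ n h0 _ Ha.
  have scale (y b q : R) : y * q = 1 -> c * y ^+ 3 * b * q ^+ 2 = c * b * y.
    by move=> yq; rewrite -[RHS]mulr1 -(expr1n R 2) -yq; ring.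
  rewrite scale // in Ha.
  apply: Ha => k kn.
  apply: (Dle 3 0) => //.
  rewrite subr_ge0 ler_pdivrMr // mul1r ler_nat; exact: ltnW.
have real_le (x : R) z : `|x| <= c * h ->
    `|real_complex R x *: phi z| <= real_complex R (c * h * re (phi z)).
  move=> xc; rewrite normrM rmorphM /= -reE ler_wpM2r //.
  by rewrite normc_def /= expr0n addr0 sqrtr_sqr lecR.
rewrite linearD [phi (_ + (_ + _))]linearD [phi (_ + forced _ _ _ _)]linearD.
rewrite !linearZ_LR addrAC -[X in _ - X]scale1r -scalerBl.
have -> : real_complex R (f 0 h) - 1 = real_complex R (f 0 h - 1).
  by rewrite rmorphB.
apply: le_trans (ler_normD _ _) _.
rewrite -!addrA !mulrDl ![in leRHS]rmorphD; apply: lerD.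
  by have := real_le _ W D0; rewrite mulrAC.
apply: le_trans (ler_normD _ _) _; apply: lerD.
  by have := real_le _ W1 D1; rewrite mulrAC.
apply: le_trans (ler_normD _ _) _; apply: lerD => //.
by have := real_le _ W2 D2; rewrite mulrAC.
Qed.

End Forced.

Arguments forced {R V}.

(** * Uniform bounds on the derivatives of the window *)

Section WindowDerivatives.
Variables (R : realType) (chi : R -> R).
Hypothesis chi_window : admissible_window (@class_Cinf R) chi.

Lemma window_is_derive k (x : R) :
  is_derive x 1 (derive1n k chi) (derive1n k.+1 chi x).
Proof.
have [d _] := window_reg chi_window k.+1.
by rewrite derive1nS derive1E; apply: derivableP; apply: d.
Qed.

(** The strict inequality provides a neighbourhood of [x] on which the previous derivative
    vanishes. *)
Lemma window_deriv_gt1 k x : 1 < x -> derive1n k chi x = 0.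
Proof.
elim: k x => [|k IH] x x1; first by apply: (window_ge1 chi_window); exact: ltW.
rewrite derive1nS derive1E (@near_eq_derive _ _ _ _ (cst 0)) ?derive_cst //.
by near do apply: IH; exact: lt_nbhsr.
Unshelve. all: by end_near. Qed.

Lemma window_deriv_bounded J :
  exists c : R, forall k x, (k <= J)%N -> 0 <= x -> `|derive1n k chi x| <= c.
Proof.
have bnd k : exists c : R, forall x, 0 <= x -> `|derive1n k chi x| <= c.
  have [_ ck] := window_reg chi_window k.
  have ck01 : {within `[0, 1], continuous (derive1n k chi)}.
    exact: continuous_subspaceT.
  have /compact_bounded[c [_ Hc]] :=
    continuous_compact ck01 (@segment_compact R 0 1).
  (* Boundedness on the compact interval only supplies bounds strictly above [c], hence the
     [+ 1]. *)
  exists (`|c| + 1) => x x0; have [x1|x1] := leP x 1.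
    apply: (Hc (`|c| + 1)); first by rewrite (le_lt_trans (ler_norm _)) // ltrDl.
    by exists x => //=; rewrite in_itv /= x0.
  by rewrite window_deriv_gt1 // normr0 addr_ge0.
elim: J => [|J [c Hc]].
  by have [c Hc] := bnd 0; exists c => k x; rewrite leqn0 => /eqP->; exact: Hc.
have [c' Hc'] := bnd J.+1; exists (Num.max c c') => k x.
rewrite leq_eqVlt le_max => /predU1P[->|kJ] x0; first by rewrite Hc' ?orbT.
by rewrite Hc.
Qed.

End WindowDerivatives.

(** * The homogeneous leapfrog map *)

Section Leapfrog.
Variables (F : comNzRingType) (N : nat) (K L : 'M[F]_N).

(** The scalar ring is generic because the energy argument runs over [R] and the scheme over
    [R[i]]. *)
Definition leapfrog (p : 'cV[F]_N * 'cV[F]_N) : 'cV[F]_N * 'cV[F]_N :=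
  ((2%:M - K - L) *m p.1 - (1%:M - L) *m p.2, p.1).

Lemma leapfrog_linear : linear leapfrog.
Proof.
move=> a [x y] [x' y']; rewrite /leapfrog /=.
rewrite !mulmxDr -!scalemxAr opprD addrACA -scalerBr.
by [].
Qed.

HB.instance Definition _ :=
  GRing.isLinear.Build F _ _ _ leapfrog leapfrog_linear.

End Leapfrog.

Arguments leapfrog {F N}.

Definition mxform {R : realType} {N : nat} (M : 'M[R]_N) (x y : 'cV[R]_N) : R :=
  (x^T *m M *m y) 0 0.

(** * Discrete energy and linear growth *)

Section Energy.
Variables (R : realType) (N : nat).
Implicit Types (M : 'M[R]_N) (x y : 'cV[R]_N).

Lemma mxformDl M x y z : mxform M (x + y) z = mxform M x z + mxform M y z.
Proof. by rewrite /mxform linearD /= !mulmxDl mxE. Qed.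

Lemma mxformDr M x y z : mxform M x (y + z) = mxform M x y + mxform M x z.
Proof. by rewrite /mxform !mulmxDr mxE. Qed.

Lemma mxformNl M x y : mxform M (- x) y = - mxform M x y.
Proof. by rewrite /mxform linearN /= !mulNmx mxE. Qed.

Lemma mxformNr M x y : mxform M x (- y) = - mxform M x y.
Proof. by rewrite /mxform !mulmxN mxE. Qed.

Lemma mxformC M x y : M^T = M -> mxform M x y = mxform M y x.
Proof.
move=> MT; rewrite /mxform; transitivity ((x^T *m M *m y)^T 0 0).
  by rewrite [in RHS]mxE.
by rewrite !trmx_mul trmxK MT mulmxA.
Qed.

Definition mxformE := (mxformDl, mxformDr, mxformNl, mxformNr).

Lemma posdefmx_unit M : posdefmx M -> M \in unitmx.
Proof.
case=> _ pM; rewrite unitmxE unitfE; apply/negP => /det0P[v v0 vM].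
have := pM v^T; rewrite trmxK vM mul0mx mxE ltxx => H.
by have: false by apply: H; rewrite -trmx0 (inj_eq trmx_inj).
Qed.

(* Each coordinate is [mxform M y (M^-1 e_i)], so a Cauchy-Schwarz argument in
   the form of [M] replaces a lower bound on its spectrum. *)
Lemma posdefmx_coord_le M i : posdefmx M ->
  exists c : R, forall y, `|y i 0| <= mxform M y y + c.
Proof.
move=> pM; have uM := posdefmx_unit M pM; have [MT pM'] := pM.
have M_ge0 y : 0 <= mxform M y y.
  have [->|y0] := eqVneq y 0; last exact/ltW/pM'.
  by rewrite /mxform mulmx0 mxE.
pose w : 'cV[R]_N := invmx M *m delta_mx i 0.
exists (mxform M w w) => y.
have -> : y i 0 = mxform M y w.
  by rewrite /mxform /w mulmxA mulmxK // -colE !mxE.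
(* Nonnegativity at [y + w] and [y - w] bounds twice the mixed term by the sum of the two
   squares. *)
have := M_ge0 (y + w); have := M_ge0 (y - w).
rewrite !mxformE (mxformC _ w y) // => h1 h2.
rewrite ler_norml; apply/andP; split; have := M_ge0 w; have := M_ge0 y; lra.
Qed.


Variables (K L : 'M[R]_N).
Hypotheses (K_psd : psdmx K) (L_psd : psdmx L).
Hypothesis KL_posdef : posdefmx (4%:M - K - 2 *: L).

Implicit Types p : 'cV[R]_N * 'cV[R]_N.

(* For [p = (u_n, u_(n-1))] this is four times
   [|d|^2 + <K u_n, u_(n-1)> - <L d, d> / 2] with [d = u_n - u_(n-1)], written as
   a sum of two nonnegative terms. *)
Definition energy (p : 'cV[R]_N * 'cV[R]_N) : R :=
  mxform (4%:M - K - 2 *: L) (p.1 - p.2) (p.1 - p.2)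
  + mxform K (p.1 + p.2) (p.1 + p.2).

Lemma mxform1M M x y : mxform 1%:M x (M *m y) = mxform M x y.
Proof. by rewrite /mxform mulmx1 mulmxA. Qed.

Lemma mxform_energy x y :
  mxform (4%:M - K - 2 *: L) x y
  = 4 * mxform 1%:M x y - mxform K x y - 2 * mxform L x y.
Proof.
rewrite /mxform !(mulmxBl, mulmxBr) mul_mx_scalar mulmx1 -!scalemxAl -scalemxAr.
by rewrite -!scalemxAl !mxE.
Qed.

(** The multiplier is the centred difference [u_(n+1) - u_(n-1)]: paired with it, the second
    difference and the [K] term form an exact energy increment, and the loss comes from [L]
    alone. *)
Lemma energy_leapfrog p :
  energy (leapfrog K L p)
  = energy p
    - 2 * mxform L ((leapfrog K L p).1 - p.2) ((leapfrog K L p).1 - p.2).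
Proof.
have [[KT _] [LT _]] := (K_psd, L_psd).
case: p => a b; rewrite /energy.
set w := (leapfrog K L (a, b)).1; rewrite -[(leapfrog K L (a, b)).2]/a /=.
have IT : (1%:M : 'M[R]_N)^T = 1%:M by rewrite trmx1.
have key : mxform 1%:M (w - b) (w - 2 *: a + b)
           = - mxform K (w - b) a - mxform L (w - b) (a - b).
  have -> : w - 2 *: a + b = - (K *m a) - L *m (a - b).
    rewrite /w /= !mulmxBl !mulmxBr mul_scalar_mx mul1mx.
    move: (K *m a) (L *m a) (L *m b) => k l m.
    by apply/matrixP => i j; rewrite !mxE; ring.
  by rewrite [LHS]mxformDr !mxformNr !mxform1M.
clearbody w; move: key; rewrite scaler_nat mulr2n !mxform_energy !mxformE.
rewrite !(mxformC _ a w) // !(mxformC _ b w) // !(mxformC _ b a) //.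
lra.
Qed.

(** The energy never exceeds its initial value, and its positive definite part controls only the
    increment [u_n - u_(n-1)]; adding up uniformly bounded increments gives linear growth. *)
Lemma leapfrog_growth p i :
  exists a : R, forall n, `|(iter n (leapfrog K L) p).1 i 0| <= a * n.+1%:R.
Proof.
have [KT K_ge0] := K_psd; have [LT L_ge0] := L_psd.
have [c Hc] := posdefmx_coord_le _ i KL_posdef.
have dec n : energy (iter n (leapfrog K L) p) <= energy p.
  elim: n => //= n; apply: le_trans.
  by rewrite energy_leapfrog gerBl mulr_ge0 // L_ge0.
pose b := `|energy p + c|.
have step n : `|(iter n.+1 (leapfrog K L) p).1 i 0|
    <= `|(iter n (leapfrog K L) p).1 i 0| + b.
  set q := iter n _ p; set q' := iter n.+1 _ p.
  have -> : q'.1 i 0 = q.1 i 0 + (q'.1 - q'.2) i 0.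
    have -> : q.1 = q'.2 by [].
    by clearbody q'; rewrite !mxE; lra.
  apply: le_trans (ler_normD _ _) _; rewrite lerD2l.
  apply: le_trans (Hc _) (le_trans _ (ler_norm _)); rewrite lerD2r.
  by apply: le_trans (dec n.+1); rewrite lerDl K_ge0.
exists (`|p.1 i 0| + b); elim=> [|n IH].
  by rewrite mulr1 lerDl normr_ge0.
apply: le_trans (step n) _; rewrite -[n.+2%:R]natr1 mulrDr mulr1 lerD //.
by rewrite lerDr.
Qed.

End Energy.

Lemma toC_leapfrog (R : realType) N (K L : 'M[R]_N) (p : 'cV[R]_N * 'cV[R]_N) :
  leapfrog (toC K) (toC L) (toC p.1, toC p.2)
  = (toC (leapfrog K L p).1, toC (leapfrog K L p).2).
Proof.
rewrite /leapfrog /toC /= !(map_mxB, map_mxM) !map_scalar_mx.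
by rewrite !rmorphMn !rmorph1.
Qed.

(** Since [K] and [L] are real, the real and imaginary parts of a state evolve separately, each by
    the real scheme. *)
Lemma leapfrog_growthC (R : realType) N (K L : 'M[R]_N)
    (p : 'cV[R[i]]_N * 'cV[R[i]]_N) i :
    psdmx K -> psdmx L -> posdefmx (4%:M - K - 2 *: L) ->
  exists a : R, forall n,
    `|(iter n (leapfrog (toC K) (toC L)) p).1 i 0|
      <= real_complex R (a * n.+1%:R).
Proof.
move=> K_psd L_psd KL_posdef.
pose re m (M : 'M[R[i]]_(m, 1)) := map_mx (@complex.Re R) M.
pose im m (M : 'M[R[i]]_(m, 1)) := map_mx (@complex.Im R) M.
have pE : p = (toC (re _ p.1), toC (re _ p.2))
              + 'i%C *: (toC (im _ p.1), toC (im _ p.2)).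
  by case: p => x y; congr pair; apply/matrixP => k l; rewrite !mxE -complexE.
have itE q n : iter n (leapfrog (toC K) (toC L)) (toC q.1, toC q.2) =
    (toC (iter n (leapfrog K L) q).1, toC (iter n (leapfrog K L) q).2).
  by elim: n => //= n ->; rewrite toC_leapfrog.
have [a Ha] := leapfrog_growth _ _ _ _ K_psd L_psd KL_posdef
  (re _ p.1, re _ p.2) i.
have [b Hb] := leapfrog_growth _ _ _ _ K_psd L_psd KL_posdef
  (im _ p.1, im _ p.2) i.
exists (a + b) => n.
have -> : iter n (leapfrog (toC K) (toC L)) p =
    iter n (leapfrog (toC K) (toC L)) (toC (re _ p.1), toC (re _ p.2))
    + 'i%C *:
      iter n (leapfrog (toC K) (toC L)) (toC (im _ p.1), toC (im _ p.2)).
  rewrite [in LHS]pE; elim: n => //= n ->.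
  by rewrite linearD linearZ.
have normR (x : R) : `|real_complex R x| = real_complex R `|x|.
  by rewrite normc_def /= expr0n addr0 sqrtr_sqr.
rewrite (itE (_, _)) (itE (im _ p.1, im _ p.2)) /= !mxE.
apply: le_trans (ler_normD _ _) _; rewrite normrM !normR.
have -> : `|'i%C : R[i]| = 1.
  by rewrite normc_def /= expr0n expr1n add0r sqrtr1.
by rewrite mul1r -rmorphD lecR mulrDl lerD ?Ha ?Hb.
Qed.

(** * Removing the oscillation by a phase rotation *)

Section Twist.
Variable R : realType.
Implicit Types s t : R.

Lemma expiD s t : expi (s + t) = expi s * expi t.
Proof. by rewrite /expi cosD sinD; simpc; rewrite [X in Complex _ X]addrC. Qed.

Lemma expiX t n : expi t ^+ n = expi (t * n%:R).
Proof.
elim: n => [|n IH]; first by rewrite mulr0 /expi cos0 sin0.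
by rewrite exprS IH -expiD -natr1 mulrDr mulr1 addrC.
Qed.

Lemma expiNK t : expi (- t) * expi t = 1.
Proof. by rewrite -expiD addNr /expi cos0 sin0. Qed.

Lemma expi_neq0 t : expi t != 0.
Proof.
apply/eqP => e0; have := expiNK t; rewrite e0 mulr0 => /esym/eqP.
by rewrite oner_eq0.
Qed.

Lemma expiV t : (expi t)^-1 = expi (- t).
Proof. by apply: (mulIf (expi_neq0 t)); rewrite expiNK mulVf ?expi_neq0. Qed.

Lemma norm_expi t : `|expi t| = 1.
Proof. by rewrite normc_def /= cos2Dsin2 sqrtr1. Qed.

Variable N : nat.

Definition coord_fst (i : 'I_N) (p : 'cV[R[i]]_N * 'cV[R[i]]_N) : R[i]^o :=
  p.1 i 0.

Lemma coord_fst_linear i : linear (coord_fst i).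
Proof. by move=> a p q; rewrite /coord_fst /= !mxE. Qed.

HB.instance Definition _ i :=
  GRing.isLinear.Build R[i] _ _ _ (coord_fst i) (coord_fst_linear i).

(** Dividing by [z] at each step cancels the phase of the load, so that only the slowly varying
    window remains in the forcing. *)
Definition twisted_leapfrog (z : R[i]) (K L : 'M[R[i]]_N)
    (p : 'cV[R[i]]_N * 'cV[R[i]]_N) : 'cV[R[i]]_N * 'cV[R[i]]_N :=
  z^-1 *: leapfrog K L p.

Lemma twisted_leapfrog_linear z K L : linear (twisted_leapfrog z K L).
Proof.
move=> a p q; rewrite /twisted_leapfrog linearP scalerDr.
by rewrite !scalerA mulrC.
Qed.

HB.instance Definition _ z K L := GRing.isLinear.Build R[i] _ _ _
  (twisted_leapfrog z K L) (twisted_leapfrog_linear z K L).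

Lemma iter_twisted_leapfrog z K L p n :
  iter n (twisted_leapfrog z K L) p = z^-1 ^+ n *: iter n (leapfrog K L) p.
Proof.
elim: n => [|n IH]; first by rewrite expr0 scale1r.
by rewrite !iterS IH /twisted_leapfrog linearZ scalerA exprS.
Qed.

End Twist.

Arguments twisted_leapfrog {R N}.

(** * The symbol of the scheme and the rate of convergence *)

Section Scheme.
Variables (R : realType) (N : nat) (A B : 'M[R]_N) (omega dt : R).
Hypotheses (omega_gt0 : 0 < omega) (dt_gt0 : 0 < dt).
Hypothesis sin_neq0 : sin (omega * dt) != 0.

Let K := toC (abd_K A B omega dt).
Let L := toC (abd_L B omega dt).
Let z := expi (omega * dt).
Let gamma := dt ^+ 2 / abd_alpha omega dt.
Let V : lmodType R[i] := ('cV[R[i]]_N * 'cV[R[i]]_N)%type.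
Let Q : {linear V -> V} := twisted_leapfrog z K L.

Lemma abd_gammaE : gamma * omega ^+ 2 = 2 - 2 * cos (omega * dt).
Proof.
by rewrite /gamma /abd_alpha invf_div exprMn; field; rewrite !gt_eqF.
Qed.

Lemma abd_gamma_neq0 : gamma != 0.
Proof.
apply: contraNneq sin_neq0 => g0; have := abd_gammaE; rewrite g0 mul0r => c1.
have := cos2Dsin2 (omega * dt); have -> : cos (omega * dt) = 1 by lra.
by move=> s0; rewrite -sqrf_eq0; apply/eqP; lra.
Qed.

(** Here [z + z^-1 - 2 = - gamma omega^2]. In [1 - z^-1 = (1 - cos) + i sin], the factor of [L], the
    cosine part is cancelled by the [B] term of [K], and the sine part yields [i gamma omega B]. *)
Lemma abd_symbol :
  z%:M - (2%:M - K - L) + z^-1 *: (1%:M - L)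
  = real_complex R gamma *: helmholtz A B omega.
Proof.
have gE := abd_gammaE.
have bE : abd_beta omega dt * dt / abd_alpha omega dt * sin (omega * dt)
          = gamma * omega.
  by rewrite /abd_beta /gamma; move: (abd_alpha omega dt)^-1 => al; field.
apply/matrixP => i j; rewrite /K /L /toC /abd_K /abd_L -/gamma.
rewrite /z expiV !mxE.
set l := _ * dt / _ in bE *.
have -> : dt * abd_beta omega dt * (1 - cos (omega * dt)) / abd_alpha omega dt
          = l * (1 - cos (omega * dt)) by rewrite /l; ring.
have bEB : l * sin (omega * dt) * B i j = gamma * omega * B i j by rewrite bE.
clearbody l gamma; rewrite /expi cosN sinN; set c := cos _ in gE *.
set s := sin _ in bEB *; apply/eqP.
case: (i == j); rewrite ?mulr1n ?mulr0n eq_complex; simpc;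
  apply/andP; split; apply/eqP.
all: simpl; lra.
Qed.

(** The second component of the equation determines the second unknown as [z^-1 x + b]; eliminating
    it leaves the symbol applied to [x]. *)
Lemma twisted_leapfrog_solve (a b : 'cV[R[i]]_N) :
    helmholtz A B omega \in unitmx ->
  let x := (real_complex R gamma)^-1 *:
    (invmx (helmholtz A B omega) *m (z *: a - (1%:M - L) *m b)) in
  (x, z^-1 *: x + b) - Q (x, z^-1 *: x + b) = (a, b).
Proof.
move=> uH x; have z0 : z != 0 := expi_neq0 _ _.
have g0 : real_complex R gamma != 0.
  by apply: contraNneq abd_gamma_neq0 => /complexI->.
have Hx : (real_complex R gamma *: helmholtz A B omega) *m x
          = z *: a - (1%:M - L) *m b.
  by rewrite /x -scalemxAl -scalemxAr scalerA mulfV // mulKVmx ?scale1r.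
have xE : z *: x - (2%:M - K - L) *m x + z^-1 *: ((1%:M - L) *m x)
          = z *: a - (1%:M - L) *m b.
  rewrite -Hx -abd_symbol [in RHS]mulmxDl [in RHS]mulmxBl.
  by rewrite mul_scalar_mx -scalemxAl.
clearbody x; have zaE := esym (subrK ((1%:M - L) *m b) (z *: a)).
rewrite -xE in zaE.
rewrite /Q /twisted_leapfrog /leapfrog /=.
congr pair; last by rewrite /= addrAC subrr add0r.
apply: (scalerI z0); rewrite [RHS]zaE /= scalerBr scalerA mulfV // scale1r.
rewrite [in LHS]mulmxDr -scalemxAr opprB addrA -!addrA.
by congr (_ + _); rewrite addrA addrC.
Qed.

Let source (F : 'cV[R[i]]_N) : V := (real_complex R gamma *: F, 0).

(** The load of step [n] has phase [z ^+ n] but enters [u_(n+1)], hence the factor [z^-1] on the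
    source. *)
Lemma abd_stateE chi T F n :
  abd_state A B omega dt chi T F n
  = z ^+ n *: forced Q (dt / (2 * pi * omega^-1 * T)) chi (z^-1 *: source F) n
  :> V.
Proof.
elim: n => [|n IH]; first by rewrite scaler0.
have -> : abd_state A B omega dt chi T F n.+1 =
    leapfrog K L (abd_state A B omega dt chi T F n)
    + (real_complex R gamma *: abd_rhs omega dt chi T F n, 0).
  rewrite /=; case: (abd_state _ _ _ _ _ _ _ n) => u v.
  by congr pair; rewrite addr0.
rewrite forcedS IH scalerDr; congr (_ + _).
  by rewrite linearZ /Q /= /twisted_leapfrog scalerA exprSr mulfK // expi_neq0.
have zn : expi (omega * n%:R * dt) = z ^+ n by rewrite /z expiX mulrAC.
rewrite /abd_rhs zn mulrA; congr pair; last by rewrite /= !scaler0.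
rewrite /= !scalerA exprSr; congr (_ *: _); field.
exact: expi_neq0.
Qed.

Hypothesis H_unit : helmholtz A B omega \in unitmx.

(** The factors [z] and [gamma] of the source cancel against those of the resolvent, so time
    stepping leaves no discretization error in the limit. *)
Lemma abd_source_solve (F : 'cV[R[i]]_N) : exists2 W : V,
  W - Q W = z^-1 *: source F & W.1 = invmx (helmholtz A B omega) *m F.
Proof.
have z0 : z != 0 := expi_neq0 _ _.
have g0 : real_complex R gamma != 0.
  by apply: contraNneq abd_gamma_neq0 => /complexI->.
have := twisted_leapfrog_solve (z^-1 *: (real_complex R gamma *: F)) 0 H_unit.
rewrite mulmx0 subr0 scalerA mulfV // scale1r -scalemxAr scalerA mulVf // scale1r.
move=> E; eexists (_, _); last by [].
by apply: (etrans E); congr pair; rewrite /= scaler0.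
Qed.

Lemma abd_mx_rate chi i j :
    psdmx (abd_K A B omega dt) -> psdmx (abd_L B omega dt) ->
    posdefmx (4%:M - abd_K A B omega dt - 2 *: abd_L B omega dt) ->
    admissible_window (@class_Cinf R) chi ->
  exists C : R, forall T, abd_times omega dt T ->
    `|abd_mx A B omega dt chi T i j - invmx (helmholtz A B omega) i j|
      <= real_complex R (C / abd_nsteps omega dt T).
Proof.
move=> K_psd L_psd KL_posdef chi_window.
have [W WE W1] := abd_source_solve (delta_mx j 0).
have [c Hc] := window_deriv_bounded _ _ chi_window 3.
have growth (G : V) : exists a : R, forall n,
    `|coord_fst _ _ i (iter n Q G)| <= real_complex R (a * n.+1%:R).
  have [a Ha] := leapfrog_growthC _ _ _ _ G i K_psd L_psd KL_posdef.
  exists a => n; rewrite iter_twisted_leapfrog /coord_fst mxE normrM normrX.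
  by rewrite /z expiV norm_expi expr1n mul1r Ha.
have solve (G : V) : exists W' : V, W' - Q W' = G.
  case: G => a b; have := twisted_leapfrog_solve a b H_unit.
  by move=> E; eexists; exact: E.
have [C HC] := forced_rate _ _ Q (coord_fst _ _ i) (fun k => derive1n k chi) c
  (z^-1 *: source (delta_mx j 0)) W (window_is_derive _ _ chi_window) Hc
  (window_ge1 chi_window) (window0 chi_window) solve growth WE.
exists C => T [T0 Tint].
have n0 : 0 < abd_nsteps omega dt T.
  by rewrite /abd_nsteps !(mulr_gt0, divr_gt0, invr_gt0, pi_gt0).
(* Membership in [abd_times] makes the step count a natural number [n], and the window is then
   sampled with spacing exactly [1 / n]. *)
have := Tint; rewrite intrEge0 ?(ltW n0) // => /natrP [n nE].
have hE : dt / (2 * pi * omega^-1 * T) = n%:R^-1.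
  by rewrite -nE /abd_nsteps invf_div.
have n_gt0 : (0 < n)%N by rewrite -(ltr0n R) -nE.
have -> : invmx (helmholtz A B omega) i j
    = coord_fst _ _ i W by rewrite /coord_fst W1 -colE mxE.
suff -> : abd_mx A B omega dt chi T i j = coord_fst _ _ i
    (forced Q n%:R^-1 chi (z^-1 *: source (delta_mx j 0)) n).
  by rewrite nE; exact: HC.
rewrite mxE /abd_op nE natrK abd_stateE hE /coord_fst; set X := forced _ _ _ _ _.
rewrite [(z ^+ n *: X).1](_ : _ = z ^+ n *: X.1) // scalerA mxE.
(* The final phase factor of [abd_op] is thus the inverse of [z ^+ n]. *)
have -> : 2 * pi * T = omega * dt * n%:R.
  by rewrite -nE /abd_nsteps; field; rewrite !gt_eqF.
by rewrite /z expiX expiNK mul1r.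
Qed.

End Scheme.

Theorem theorem7 (R : realType) (N : nat) (A B : 'M[R]_N) (omega dt : R)
    (chi : R -> R)
    (A_sym : A^T = A) (B_sym : B^T = B)
    (omega_gt0 : 0 < omega) (dt_gt0 : 0 < dt)
    (sin_neq0 : sin (omega * dt) != 0)
    (H_nonsing : helmholtz A B omega \in unitmx)
    (K_psd : psdmx (abd_K A B omega dt))
    (L_psd : psdmx (abd_L B omega dt))
    (KL_posdef :
      posdefmx (4%:M - abd_K A B omega dt - 2 *: abd_L B omega dt))
    (chi_window : admissible_window (@class_Cinf R) chi) :
  abd_mx A B omega dt chi T @[T --> within (abd_times omega dt) (pinfty_nbhs R)]
    --> invmx (helmholtz A B omega).
Proof.
apply/cvg_ballP => e e0.
(* Radii live in [R[i]]; a positive one is real and can be compared with the real rate. *)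
have eE : e = real_complex R (complex.Re e) by rewrite RRe_real // gtr0_real.
have e'0 : 0 < complex.Re e by rewrite -ltcR -eE.
suff near_entry i j : \forall T \near within (abd_times omega dt) (pinfty_nbhs R),
    ball (invmx (helmholtz A B omega) i j) e (abd_mx A B omega dt chi T i j).
  have : \forall T \near within (abd_times omega dt) (pinfty_nbhs R), forall i j,
      ball (invmx (helmholtz A B omega) i j) e (abd_mx A B omega dt chi T i j).
    by apply: filter_forall => i; apply: filter_forall => j.
  by apply: filterS => T HT; split.
have [C HC] := abd_mx_rate _ _ A B _ _ omega_gt0 dt_gt0 sin_neq0 H_nonsing
  chi i j K_psd L_psd KL_posdef chi_window.
rewrite near_withinE; near=> T => TT.
rewrite -ball_normE /= distrC (le_lt_trans (HC T TT)) // eE ltcR.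
have [T0 _] := TT; rewrite ltr_pdivrMr; last first.
  by rewrite /abd_nsteps !(mulr_gt0, divr_gt0, invr_gt0, pi_gt0).
(* The step count is a positive constant times [T], so the bound becomes an explicit threshold on
   [T]. *)
rewrite -ltr_pdivrMl // /abd_nsteps.
have c0 : 0 < 2 * pi * omega^-1 / dt :> R.
  by rewrite !(mulr_gt0, divr_gt0, invr_gt0, pi_gt0).
rewrite mulrAC -ltr_pdivrMl //.
by near: T; apply: nbhs_pinfty_gt; exact: num_real.
Unshelve. all: by end_near. Qed.
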